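(* Let $\mathcal{A}$ be a recursive subset of $\mathbb{Z}$ that is closed in $\mathcal{PT}(\mathbb{Z})$ but not effectively closed in $\mathcal{PT}(\mathbb{Z})$. Then the depth function $\rho_{L(\mathcal{A})}$ of the group $L(\mathcal{A})$ cannot be smaller than a recursive function: there is no recursive function $f:\mathbb{N}\to\mathbb{N}$ such that $\rho_{L(\mathcal{A})}(n)\leq f(n)$ for all $n\in\mathbb{N}$.
   Context: For $\mathcal{A}\subseteq\mathbb{Z}$, $L(\mathcal{A})$ is the group with presentation \[ \langle a,\hat{a},\varepsilon,\hat{\varepsilon}\mid \varepsilon^{2},\ \hat{\varepsilon}^{2},\ [\varepsilon,a^{i}\varepsilon a^{-i}],\ [\hat{\varepsilon},\hat{a}^{i}\hat{\varepsilon}\hat{a}^{-i}]\ (i\in\mathbb{Z}),\ a^{j}\varepsilon a^{-j}=\hat{a}^{j}\hat{\varepsilon}\hat{a}^{-j}\ (j\in\mathcal{A})\rangle . \] It is a known result (Dyson) that $L(\mathcal{A})$ is residually finite if and only if $\mathcal{A}$ is closed in $\mathcal{PT}(\mathbb{Z})$. $\mathcal{PT}(\mathbb{Z})$ denotes the profinite topology on $\mathbb{Z}$: a set $O\subseteq\mathbb{Z}$ is open if and only if for every $n\in O$ there is an integer $p\geq 1$ with $n+p\mathbb{Z}\subseteq O$. An open set $O$ is effectively open if there is an effective procedure (algorithm) that, given any $n\in O$, computes an integer $p\geq 1$ such that $n+p\mathbb{Z}\subseteq O$ (nothing is required on inputs outside $O$). A set is effectively closed if its complement is effectively open. A set is recursive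 if its membership problem is decidable by an algorithm. The depth function (residual finiteness growth function) $\rho_G$ of a finitely generated residually finite group $G$ associates to a natural number $n$ the smallest number $k$ such that, for any non-trivial element of length at most $n$ in $G$, there exists a finite quotient of $G$ of order at most $k$ in which the image of this element is non-trivial. Length is word length with respect to a fixed finite generating set; for $L(\mathcal{A})$ the generating set is $\{a,\hat{a},\varepsilon,\hat{\varepsilon}\}$. *)

(* Defs.v *)
From HB Require Import structures.
From mathcomp Require Import all_boot all_order all_algebra all_fingroup.
From mathcomp Require Import generic_quotient boolp classical_sets.
Set Implicit Arguments.
Unset Strict Implicit.
Unset Printing Implicit Defensive.
Import GRing.Theory.

(* Programs for the partial recursive functions. They are untyped in their
   arity: they run on a list of arguments, and a missing argument reads as 0.
   [Succ] acts on the first argument; [Prec] recurses on the first argument;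
   [Mu] searches for a new first argument. *)

Inductive program : Type :=
| Zero
| Succ
| Proj of nat
| Comp of program & seq program
| Prec of program & program
| Mu of program.

(* [computes p xs y]: the program [p] halts on [xs] with output [y]. *)
Fixpoint computes (p : program) (xs : seq nat) (y : nat) {struct p} : Prop :=
  match p with
  | Zero => y = 0
  | Succ => y = (head 0 xs).+1
  | Proj i => y = nth 0 xs i
  | Comp q qs =>
      exists2 ys : seq nat,
        (fix computes_all (qs : seq program) (ys : seq nat) {struct qs} :=
           match qs, ys with
           | [::], [::] => True
           | q' :: qs', y' :: ys' => computes q' xs y' /\ computes_all qs' ys'
           | _, _ => False
           end) qs ys
        & computes q ys y
  | Prec q r =>
      (fix iterates (n : nat) (z : nat) {struct n} : Prop :=
         match n with
         | 0 => computes q (behead xs) z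
         | n'.+1 => exists2 t : nat, iterates n' t
                      & computes r [:: n', t & behead xs] z
         end) (head 0 xs) y
  | Mu q => computes q (y :: xs) 0 /\
      (forall i, i < y -> exists t : nat, computes q (i :: xs) t.+1)
  end.

(* The generated induction principle has no hypothesis on the arguments of
   [Comp], hence the explicit recursion. *)
Lemma computes_inj : forall p xs y z,
  computes p xs y -> computes p xs z -> y = z.
Proof.
fix IH 1; case=> [||i|q qs|q r|q] xs y z /=.
- by move=> -> ->.
- by move=> -> ->.
- by move=> -> ->.
- move=> [ys yss qy] [zs zss qz].
  suff eyz : ys = zs by rewrite -eyz in qz; exact: IH qy qz.
  elim: qs ys zs yss zss {qy qz} => [|q' qs IHqs] [|y' ys] [|z' zs] //=.
  by move=> [qy yss] [qz zss]; rewrite (IH _ _ _ _ qy qz) (IHqs _ _ yss zss).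
- elim: (head 0 xs) y z => [|n IHn] y z; first exact: IH.
  by move=> [s ns ry] [t nt rz]; rewrite (IHn _ _ ns nt) in ry; exact: IH ry rz.
- move=> [qy hy] [qz hz]; case: (ltngtP y z) => // lt.
  + by have [t /(IH _ _ _ _ qy)] := hz _ lt.
  + by have [t /(IH _ _ _ _ qz)] := hy _ lt.
Qed.

Definition recursive_fun (f : nat -> nat) : Prop :=
  exists p : program, forall n : nat, computes p [:: n] (f n).

(* The bijection of the integers with the natural numbers through which
   programs read an integer: n is sent to 2n, and -n-1 to 2n+1. *)
Definition int_code (n : int) : nat :=
  match n with Posz k => k.*2 | Negz k => k.*2.+1 end.

Local Open Scope classical_set_scope.

Definition recursive_set (A : set int) : Prop :=
  exists p : program, forall n : int,
    (A n -> computes p [:: int_code n] 1) /\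
    (~ A n -> computes p [:: int_code n] 0).

Definition progression (n : int) (p : nat) : set int :=
  [set (n + p%:Z * m)%R | m in [set: int]].

Definition PT_open (O : set int) : Prop :=
  forall n : int, O n -> exists2 p : nat, 1 <= p & progression n p `<=` O.

Definition PT_closed (A : set int) : Prop := PT_open (~` A).

Definition effectively_open (O : set int) : Prop :=
  PT_open O /\
  exists e : program, forall n : int, O n ->
    exists p : nat, [/\ computes e [:: int_code n] p, 1 <= p
                      & progression n p `<=` O].

Definition effectively_closed (A : set int) : Prop := effectively_open (~` A).

Local Close Scope classical_set_scope.

(* A word is a list of letters; the letter (x, false) stands for the generator x
and (x, true) for its inverse. *)

Section Presentation.
Variable X : choiceType.

Definition word := seq (X * bool).

Definition word_inv (w : word) : word := rev [seq (l.1, ~~ l.2) | l <- w].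

Definition word_pow (x : X) (n : int) : word :=
  match n with
  | Posz k => nseq k (x, false)
  | Negz k => nseq k.+1 (x, true)
  end.

Definition word_conj (u v : word) : word := u ++ v ++ word_inv u.

Definition word_comm (u v : word) : word :=
  u ++ v ++ word_inv u ++ word_inv v.

Variable R : word -> Prop.

Inductive pres_eq : word -> word -> Prop :=
| pres_refl u : pres_eq u u
| pres_sym u v : pres_eq u v -> pres_eq v u
| pres_trans u v w : pres_eq u v -> pres_eq v w -> pres_eq u w
| pres_cancel u v x b : pres_eq (u ++ (x, b) :: (x, ~~ b) :: v) (u ++ v)
| pres_rel u v r : R r -> pres_eq (u ++ r ++ v) (u ++ v).

Definition pres_eqb (u v : word) : bool := `[< pres_eq u v >].

Fact pres_eqb_refl : reflexive pres_eqb.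
Proof. by move=> u; apply/asboolP/pres_refl. Qed.
Fact pres_eqb_sym : symmetric pres_eqb.
Proof. by move=> u v; apply/asboolP/asboolP; apply: pres_sym. Qed.
Fact pres_eqb_trans : transitive pres_eqb.
Proof. by move=> v u w /asboolP uv /asboolP vw; apply/asboolP/(pres_trans uv). Qed.

Canonical pres_equiv :=
  EquivRel pres_eqb pres_eqb_refl pres_eqb_sym pres_eqb_trans.

End Presentation.

(* The group with generators X and relators R. *)
Definition presented (X : choiceType) (R : word X -> Prop) : Type :=
  {eq_quot (pres_equiv R)}%qT.

Section PresentedGroup.
Variables (X : choiceType) (R : word X -> Prop).
Local Notation G := (presented R).
Local Notation "u =R v" := (pres_eq R u v) (at level 70).
Local Open Scope quotient_scope.

HB.instance Definition _ := Choice.copy G {eq_quot (pres_equiv R)}.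
HB.instance Definition _ := Quotient.copy G {eq_quot (pres_equiv R)}.

Definition word_class (u : word X) : G := \pi_G u.

Lemma word_classP u v : word_class u = word_class v <-> u =R v.
Proof. by split=> [/(@eqmodP _ (pres_equiv R))/asboolP //|uv]; apply/(@eqmodP _ (pres_equiv R))/asboolP. Qed.

Lemma repr_class u : repr (word_class u) =R u.
Proof. by apply/word_classP; rewrite /word_class reprK. Qed.

Lemma pres_eq_ctx u v s t : s =R t -> u ++ s ++ v =R u ++ t ++ v.
Proof.
elim=> {s t} [s|s t _|s t w _ IH _ |s t x b|s t r Rr].
- exact: pres_refl.
- exact: pres_sym.
- exact: pres_trans.
- by have := pres_cancel R (u ++ s) (t ++ v) x b; rewrite -!catA.
- by have := pres_rel (u ++ s) (t ++ v) Rr; rewrite -!catA.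
Qed.

Lemma pres_eq_cat u u' v v' : u =R u' -> v =R v' -> u ++ v =R u' ++ v'.
Proof.
move=> uu vv; apply: (pres_trans (v := u' ++ v)); first exact: (pres_eq_ctx [::] v uu).
by have := pres_eq_ctx u' [::] vv; rewrite !cats0.
Qed.

Lemma word_inv_cat (u v : word X) : word_inv (u ++ v) = word_inv v ++ word_inv u.
Proof. by rewrite /word_inv map_cat rev_cat. Qed.

Lemma word_invK : involutive (@word_inv X).
Proof.
move=> u; rewrite /word_inv map_rev revK -map_comp -[RHS]map_id.
by apply: eq_map => -[x b] /=; rewrite negbK.
Qed.

Lemma word_mulV u : u ++ word_inv u =R [::].
Proof.
elim: u => [|[x b] u IH]; first exact: pres_refl.
rewrite -cat1s word_inv_cat -catA (catA u).
apply: (pres_trans (pres_eq_ctx [:: (x, b)] (word_inv [:: (x, b)]) IH)).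
exact: (pres_cancel R [::] [::]).
Qed.

Lemma word_Vmul u : word_inv u ++ u =R [::].
Proof. by have := word_mulV (word_inv u); rewrite word_invK. Qed.

Lemma pres_eq_inv u v : u =R v -> word_inv u =R word_inv v.
Proof.
move=> uv; apply: (pres_trans (v := word_inv u ++ v ++ word_inv v)).
  apply/pres_sym; rewrite -[X in _ =R X]cats0.
  by apply: pres_eq_cat (pres_refl _ _) (word_mulV v).
rewrite catA -[X in _ =R X]cat0s; apply: pres_eq_cat (pres_refl _ _).
apply: pres_trans (word_Vmul u).
by apply: pres_eq_cat (pres_refl _ _) (pres_sym uv).
Qed.

Definition pres_one : G := word_class [::].
Definition pres_mul (g h : G) : G := word_class (repr g ++ repr h).
Definition pres_inv (g : G) : G := word_class (word_inv (repr g)).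

Lemma word_classM u v :
  word_class (u ++ v) = pres_mul (word_class u) (word_class v).
Proof. by apply/word_classP/pres_eq_cat; apply/pres_sym/repr_class. Qed.

Lemma word_classV u : word_class (word_inv u) = pres_inv (word_class u).
Proof. by apply/word_classP/pres_eq_inv/pres_sym/repr_class. Qed.

Lemma word_classK g : word_class (repr g) = g.
Proof. exact: reprK. Qed.

Fact pres_mulA : associative pres_mul.
Proof.
move=> x y z; rewrite -[x]word_classK -[y]word_classK -[z]word_classK.
by rewrite -!word_classM catA.
Qed.
Fact pres_mul1 : left_id pres_one pres_mul.
Proof. by move=> x; rewrite -[x]word_classK -word_classM. Qed.
Fact pres_mulr1 : right_id pres_one pres_mul.
Proof. by move=> x; rewrite -[x]word_classK -word_classM cats0. Qed.
Fact pres_mulVg : left_inverse pres_one pres_inv pres_mul.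
Proof.
move=> x; rewrite -[x]word_classK -word_classV -word_classM.
exact/word_classP/word_Vmul.
Qed.
Fact pres_mulgV : right_inverse pres_one pres_inv pres_mul.
Proof.
move=> x; rewrite -[x]word_classK -word_classV -word_classM.
exact/word_classP/word_mulV.
Qed.

HB.instance Definition _ :=
  isGroup.Build G pres_mulA pres_mul1 pres_mulr1 pres_mulVg pres_mulgV.

Definition pres_gen (x : X) : G := word_class [:: (x, false)].

End PresentedGroup.

(* [ahat] and [ehat] are the hatted copies of [a] and of the involution [e]. *)
Inductive Lgen := La | Lahat | Le | Lehat.

Definition Lgen_code (x : Lgen) : bool * bool :=
  match x with
  | La => (false, false) | Lahat => (false, true)
  | Le => (true, false) | Lehat => (true, true)
  end.
Definition Lgen_decode (c : bool * bool) : Lgen :=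
  match c with
  | (false, false) => La | (false, true) => Lahat
  | (true, false) => Le | (true, true) => Lehat
  end.
Fact Lgen_codeK : cancel Lgen_code Lgen_decode. Proof. by case. Qed.
HB.instance Definition _ := Finite.copy Lgen (can_type Lgen_codeK).

(* The word t^i e t^-i. *)
Definition shifted_lamp (t e : Lgen) (i : int) : word Lgen :=
  word_conj (word_pow t i) [:: (e, false)].

Inductive Lrel (A : set int) : word Lgen -> Prop :=
| Lrel_e : Lrel A [:: (Le, false); (Le, false)]
| Lrel_ehat : Lrel A [:: (Lehat, false); (Lehat, false)]
| Lrel_comm i :
    Lrel A (word_comm [:: (Le, false)] (shifted_lamp La Le i))
| Lrel_commhat i :
    Lrel A (word_comm [:: (Lehat, false)] (shifted_lamp Lahat Lehat i))
| Lrel_glue j : A j ->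
    Lrel A (shifted_lamp La Le j ++ word_inv (shifted_lamp Lahat Lehat j)).

Definition L (A : set int) : groupType := presented (Lrel A).

Definition L_gens (A : set int) : seq (L A) :=
  [:: pres_gen (Lrel A) La; pres_gen (Lrel A) Lahat;
      pres_gen (Lrel A) Le; pres_gen (Lrel A) Lehat].

Section Depth.
Variables (G : groupType) (S : seq G).
Local Open Scope group_scope.

Definition length_le (n : nat) (g : G) : Prop :=
  exists s : seq G,
    [/\ (size s <= n)%N,
        forall x, x \in s -> (x \in S) || (x^-1 \in S)
      & g = \prod_(x <- s) x].

(* [phi] exhibits the finite group [Q] as a quotient of [G]. *)
Definition separated_le (k : nat) (g : G) : Prop :=
  exists (Q : finGroupType) (phi : {multiplicative G -> Q}),
    [/\ forall q : Q, exists g' : G, phi g' = q,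
        (#|Q| <= k)%N
      & phi g <> 1].

Definition depth_bound (n k : nat) : Prop :=
  forall g : G, g <> 1 -> length_le n g -> separated_le k g.

(* Such a [rho] is unique; as [S] is finite, it exists as soon as [G] is
   residually finite. *)
Definition is_depth_function (rho : nat -> nat) : Prop :=
  forall n : nat, depth_bound n (rho n) /\
    (forall k : nat, depth_bound n k -> (rho n <= k)%N).

End Depth.

(* Main.v *)
(** A program bounding the depth of L(A) yields a modulus for the complement of
    A. For n outside A, the element a^n e a^-n (ahat^n ehat ahat^-n)^-1 is
    non-trivial and has length at most 4|n| + 2, so it survives in a quotient Q
    of order at most k = f(4|n| + 2). As k! annihilates Q, the image of this
    element only depends on n modulo k!; since the element is trivial for every
    index in A, the progression n + k!Z avoids A. *)
Require Import Defs.
From HB Require Import structures.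
From mathcomp Require Import all_boot all_order all_algebra all_fingroup.
From mathcomp Require Import boolp classical_sets.
From mathcomp Require Import zify.

Set Implicit Arguments.
Unset Strict Implicit.
Unset Printing Implicit Defensive.
Import GRing.Theory.

(** * Programs *)

Lemma computes_comp1 q p xs y z :
  computes p xs y -> computes q [:: y] z -> computes (Comp q [:: p]) xs z.
Proof. by move=> py qz; exists [:: y]. Qed.

Lemma computes_comp2 q p1 p2 xs y1 y2 z :
  computes p1 xs y1 -> computes p2 xs y2 -> computes q [:: y1; y2] z ->
  computes (Comp q [:: p1; p2]) xs z.
Proof. by move=> py1 py2 qz; exists [:: y1; y2]. Qed.

(** The step program of a [Prec] reads the counter at 0, the previous value at 1 and the remaining
    arguments from 2 on. *)
Definition add_prog := Prec (Proj 0) (Comp Succ [:: Proj 1]).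

Lemma computes_add m n : computes add_prog [:: m; n] (m + n).
Proof.
elim: m => [//|m IHm]; exists (m + n); first exact: IHm.
by apply: computes_comp1 => //.
Qed.

Definition mul_prog := Prec Zero (Comp add_prog [:: Proj 2; Proj 1]).

Lemma computes_mul m n : computes mul_prog [:: m; n] (m * n).
Proof.
elim: m => [//|m IHm]; exists (m * n); first exact: IHm.
by rewrite mulSn; apply: computes_comp2 (computes_add _ _).
Qed.

Definition fact_prog :=
  Prec (Comp Succ [:: Zero]) (Comp mul_prog [:: Comp Succ [:: Proj 0]; Proj 1]).

Lemma computes_fact n : computes fact_prog [:: n] n`!.
Proof.
elim: n => [|n IHn]; first by exists [:: 0].
exists n`!; first exact: IHn.
rewrite factS; apply: computes_comp2 (computes_mul _ _) => //.
by exists [:: n].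
Qed.

Lemma recursive_comp f g :
  recursive_fun f -> recursive_fun g -> recursive_fun (f \o g).
Proof.
move=> [p pf] [q qg]; exists (Comp p [:: q]) => n.
exact: computes_comp1 (qg n) (pf _).
Qed.

Lemma recursive_fact : recursive_fun factorial.
Proof. by exists fact_prog; apply: computes_fact. Qed.

Lemma recursive_add f g :
  recursive_fun f -> recursive_fun g -> recursive_fun (fun n => f n + g n).
Proof.
move=> [p pf] [q qg]; exists (Comp add_prog [:: p; q]) => n.
exact: computes_comp2 (pf n) (qg n) (computes_add _ _).
Qed.

Lemma recursive_id : recursive_fun id.
Proof. by exists (Proj 0). Qed.

Lemma recursive_const k : recursive_fun (fun=> k).
Proof.
elim: k => [|k [p pk]]; first by exists Zero.
by exists (Comp Succ [:: p]) => n; apply: computes_comp1 (pk n) _.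
Qed.

(** * Integer powers *)

Section IntegerPower.
Local Open Scope group_scope.

Definition expgz (G : groupType) (g : G) (n : int) : G :=
  match n with Posz k => g ^+ k | Negz k => g ^- k.+1 end.

Lemma expgz_mod (G : groupType) (g : G) (p : nat) (n : int) :
  (0 < p)%N -> g ^+ p = 1 -> expgz g n = g ^+ `|(n %% p)%Z|%N.
Proof.
move=> p_gt0 gp1; case: n => k /=.
  rewrite modz_nat absz_nat {1}(divn_eq k p) expgnDr mulnC expgnA gp1.
  by rewrite expg1n mul1g.
(* Multiplying by [g ^+ k.+1] removes the inverse; it remains that [p] divides the sum of two
   natural exponents. *)
apply/eqP; rewrite eq_sym -(inj_eq (mulIg (g ^+ k.+1))) mulVg -expgnDr.
suff /dvdnP[q ->] : (p %| `|(Negz k %% p)%Z| + k.+1)%N.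
  by rewrite mulnC expgnA gp1 expg1n.
have ? := divz_eq (Negz k) p.
have ? : (0 <= Negz k %% p)%Z%R by rewrite modz_ge0 //; lia.
apply/dvdnP; exists `|(Negz k %/ p)%Z|%N; nia.
Qed.

(** By Lagrange the order of [x] divides [#|Q|], which divides the factorial. This exponent depends
    on [k] alone, so it can be computed without knowing [Q]. *)
Lemma expg_fact_card (Q : finGroupType) (x : Q) k :
  (#|Q| <= k)%N -> x ^+ k`! = 1.
Proof.
move=> leQk; have /dvdnP[d ->] : #[x] %| k`!.
  rewrite (dvdn_trans (cardSg (finset.subsetT <[x]>))) // cardsT dvdn_fact //.
  by rewrite leQk (cardD1 1).
by rewrite mulnC expgnA expg_order expg1n.
Qed.

Lemma expgz_progression (G : groupType) (g : G) (p : nat) (n m : int) :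
  (0 < p)%N -> g ^+ p = 1 -> expgz g (n + p%:Z * m)%R = expgz g n.
Proof.
by move=> p_gt0 gp1; rewrite !(expgz_mod _ p_gt0 gp1) mulrC addrC modzMDl.
Qed.

End IntegerPower.

(** * Words in a presented group *)

Section PresentedWords.
Variables (X : choiceType) (R : word X -> Prop).
Local Open Scope group_scope.
Local Notation cls := (word_class R).

Lemma word_class_cat u v : cls (u ++ v) = cls u * cls v.
Proof. exact: word_classM. Qed.

Lemma word_class_inv u : cls (word_inv u) = (cls u)^-1.
Proof. exact: word_classV. Qed.

Lemma word_class_letter x b :
  cls [:: (x, b)] = if b then (pres_gen R x)^-1 else pres_gen R x.
Proof. by case: b => //; rewrite -word_class_inv. Qed.

Lemma word_class_nseq k l : cls (nseq k l) = cls [:: l] ^+ k.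
Proof.
elim: k => [|k IHk]; first by rewrite expg0.
by rewrite -addn1 nseqD word_class_cat IHk addn1 expgSr.
Qed.

Lemma word_class_pow x n : cls (word_pow x n) = expgz (pres_gen R x) n.
Proof. by case: n => k; rewrite word_class_nseq word_class_letter ?expVgn. Qed.

Lemma word_class_prod w : cls w = \prod_(l <- w) cls [:: l].
Proof.
elim: w => [|l w IHw]; first by rewrite big_nil.
by rewrite -cat1s word_class_cat big_cons IHw.
Qed.

Lemma word_class_rel r : R r -> cls r = 1.
Proof.
by move=> Rr; apply/word_classP; have := pres_rel [::] [::] Rr; rewrite cats0.
Qed.

End PresentedWords.

Lemma size_word_inv (X : choiceType) (w : word X) : size (word_inv w) = size w.
Proof. by rewrite size_rev size_map. Qed.

Lemma L_gens_mem A x : pres_gen (Lrel A) x \in L_gens A.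
Proof. by case: x; rewrite !inE eqxx ?orbT. Qed.

Lemma length_le_word A n (w : word Lgen) :
  size w <= n -> length_le (L_gens A) n (word_class (Lrel A) w : L A).
Proof.
move=> le_wn; exists [seq (word_class (Lrel A) [:: l] : L A) | l <- w].
split=> [|x /mapP[[y b] _ ->]|]; first by rewrite size_map.
- by rewrite word_class_letter; case: b; rewrite ?invgK L_gens_mem ?orbT.
- by rewrite word_class_prod big_map.
Qed.

(** * The gluing words *)

Definition glue_word (n : int) : word Lgen :=
  shifted_lamp La Le n ++ word_inv (shifted_lamp Lahat Lehat n).

Lemma size_glue_word n : size (glue_word n) = 4 * `|n|%N + 2.
Proof.
rewrite !(size_cat, size_word_inv) /=.
by case: n => k; rewrite /= !size_nseq; lia.
Qed.

Section GluingClass.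
Local Open Scope group_scope.

Lemma glue_word_classE A n (a := pres_gen (Lrel A) La)
    (ahat := pres_gen (Lrel A) Lahat) (e := pres_gen (Lrel A) Le)
    (ehat := pres_gen (Lrel A) Lehat) :
  word_class (Lrel A) (glue_word n) =
  (expgz a n * (e * (expgz a n)^-1)) *
    (expgz ahat n * (ehat * (expgz ahat n)^-1))^-1.
Proof.
by rewrite !(word_class_cat, word_class_inv, word_class_pow, word_class_letter).
Qed.

Lemma multiplicative_gmulf1 (G H : groupType) (phi : {multiplicative G -> H}) :
  phi 1 = 1.
Proof. by apply: (mulgI (phi 1)); rewrite -gmulfM !mulg1. Qed.

(** Between groups, compatibility with products forces 1 to go to 1; the repackaged map is the one
    to which [gmulf1], [gmulfV] and [gmulfXn] get applied. *)
Lemma multiplicative_UMagmaMorphism (G H : groupType)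
    (phi : {multiplicative G -> H}) :
  exists psi : UMagmaMorphism.type G H, (psi : G -> H) = phi.
Proof.
pose unital := Multiplicative_isUMagmaMorphism.Build G H phi
  (multiplicative_gmulf1 phi).
pose psi : UMagmaMorphism.type G H := HB.pack (phi : G -> H) unital phi.
by exists psi.
Qed.

Lemma gmulf_expgz (G H : groupType) (psi : UMagmaMorphism.type G H) g n :
  psi (expgz g n) = expgz (psi g) n.
Proof. by case: n => k /=; rewrite ?gmulfV gmulfXn. Qed.

End GluingClass.

(** * Non-triviality of the gluing words *)

(* The words act on [option int * bool], a lamp of index [None] being added to
   those indexed by the integers: [e] flips lamp 0, [a] shifts the integers, and
   the hatted generators are the conjugates of [a] and [e] by the exchange of
   [Some n] and [None]. Thus the hatted lamp of index n is lamp [None], while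
   those of any other index are the unhatted ones. *)
Section LampAction.
Variable n : int.
(** A point is a single lamp with its state, not a whole configuration: flips of distinct lamps move
    disjoint sets of points, so they already commute here. *)
Local Notation point := (option int * bool)%type.

Definition exchange (x : point) : point :=
  (if x.1 == Some n then None else if x.1 is Some i then Some i else Some n,
   x.2).

Lemma exchangeK : involutive exchange.
Proof.
case=> -[i|] b; rewrite /exchange /= ?eqxx //.
by have [[->]|/negPf->] := eqVneq (Some i) (Some n); rewrite // ?eqxx.
Qed.

Definition shift (k : int) (x : point) : point := (omap (+%R k) x.1, x.2).
Definition flip (i : int) (x : point) : point := (x.1, (x.1 == Some i) (+) x.2).

Lemma shiftD k l x : shift (k + l)%R x = shift k (shift l x).
Proof. by case: x => -[i|] b //=; rewrite /shift /= addrA. Qed.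

Lemma flipK i : involutive (flip i).
Proof. by case=> j b; rewrite /flip /= addKb. Qed.

Lemma flipC i j x : flip i (flip j x) = flip j (flip i x).
Proof. by rewrite /flip /= addbCA. Qed.

Lemma shift_flip k i x : shift k (flip i x) = flip (k + i)%R (shift k x).
Proof.
case: x => -[j|] b //; rewrite /shift /flip /=; congr (_, _ (+) _).
by rewrite !(inj_eq Some_inj) (inj_eq (addrI k)).
Qed.

(** The sign of a letter matters only for the shifts, flips being involutions. *)
Definition letter_act (l : Lgen * bool) (x : point) : point :=
  let k : int := (if l.2 then -1 else 1)%R in
  match l.1 with
  | La => shift k x
  | Lahat => exchange (shift k (exchange x))
  | Le => flip 0 x
  | Lehat => exchange (flip 0 (exchange x))
  end.

Definition word_act (w : word Lgen) (x : point) : point := foldr letter_act x w.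

Lemma word_act_cat u v x : word_act (u ++ v) x = word_act u (word_act v x).
Proof. by rewrite /word_act foldr_cat. Qed.

Lemma letter_actK g b : cancel (letter_act (g, ~~ b)) (letter_act (g, b)).
Proof.
have shiftC x : shift (if b then -1 else 1)%R
                  (shift (if ~~ b then -1 else 1)%R x) = x.
  by rewrite -shiftD; case: b x => -[[i|] c]; rewrite /shift /= ?add0r.
by case: g => x; rewrite /letter_act /= ?exchangeK ?shiftC ?flipK ?exchangeK.
Qed.

Lemma word_act_invK w : cancel (word_act (word_inv w)) (word_act w).
Proof.
elim: w => [//|[g b] w IHw] x.
by rewrite -cat1s word_inv_cat !word_act_cat IHw; apply: letter_actK.
Qed.

Lemma word_act_pow i x : word_act (word_pow La i) x = shift i x.
Proof.
case: i => k; elim: k x => [|k IHk] x //.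
- by case: x => -[j|] b; rewrite /shift /= ?add0r.
- by rewrite [in RHS]intS shiftD -IHk.
- rewrite [in RHS](_ : Negz k.+1 = (-1 + Negz k)%R); last by lia.
  by rewrite shiftD -IHk.
Qed.

Lemma word_act_powhat i x :
  word_act (word_pow Lahat i) x = exchange (shift i (exchange x)).
Proof.
suff conjE b k y : word_act (nseq k (Lahat, b)) y =
                   exchange (word_act (nseq k (La, b)) (exchange y)).
  by rewrite -word_act_pow; case: i => k; apply: conjE.
by elim: k => [|k IHk] /=; rewrite ?exchangeK // IHk /letter_act /= exchangeK.
Qed.

Lemma word_act_lamp i x : word_act (shifted_lamp La Le i) x = flip i x.
Proof.
rewrite /shifted_lamp /word_conj !word_act_cat word_act_pow shift_flip addr0.
by rewrite -word_act_pow word_act_invK.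
Qed.

Lemma word_act_lamphat i x :
  word_act (shifted_lamp Lahat Lehat i) x = exchange (flip i (exchange x)).
Proof.
rewrite /shifted_lamp /word_conj !word_act_cat word_act_powhat exchangeK.
by rewrite shift_flip addr0 -[shift _ _]exchangeK -word_act_powhat word_act_invK.
Qed.

Lemma word_act_comm u v x :
  (forall y, word_act u (word_act v y) = word_act v (word_act u y)) ->
  word_act (word_comm u v) x = x.
Proof. by move=> uvC; rewrite !word_act_cat uvC !word_act_invK. Qed.

(** The exchange moves only the lamps [Some n] and [None], and [flip j] touches neither. *)
Lemma flip_exchange j x : j != n -> exchange (flip j (exchange x)) = flip j x.
Proof.
move=> /negPf jn; case: x => -[i|] b; rewrite /exchange /flip /=; last first.
  by rewrite eqxx (inj_eq Some_inj) eq_sym jn.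
have [[->]|in_] := eqVneq (Some i) (Some n); last by rewrite (negPf in_).
by rewrite /= (inj_eq Some_inj) eq_sym jn.
Qed.

Lemma word_act_rel (A : set int) r x : ~ A n -> Lrel A r -> word_act r x = x.
Proof.
move=> An; case=> {r} [||i|i|j Aj].
- exact: flipK.
- by rewrite /= /letter_act /= exchangeK flipK exchangeK.
- by apply: word_act_comm => y; rewrite !word_act_lamp; apply: flipC.
- apply: word_act_comm => y; rewrite !word_act_lamphat /= /letter_act /=.
  by rewrite !exchangeK flipC.
(* Gluing occurs only at indices of [A], hence away from [n], where hatted and unhatted lamps act
   alike. *)
- have jn : j != n by apply/eqP => jn; rewrite -jn in An.
  rewrite word_act_cat word_act_lamp -(flip_exchange _ jn) -word_act_lamphat.
  exact: word_act_invK.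
Qed.

Lemma word_act_pres_eq (A : set int) u v :
  ~ A n -> pres_eq (Lrel A) u v -> word_act u =1 word_act v.
Proof.
move=> An; elim=> {u v} [//|u v _ IH x|u v w _ IHuv _ IHvw x|u v g b x|u v r Rr x].
- by rewrite IH.
- by rewrite IHuv IHvw.
- by rewrite !word_act_cat /= letter_actK.
- by rewrite !word_act_cat (word_act_rel _ An Rr).
Qed.

End LampAction.

Lemma glue_word_neq1 (A : set int) n :
  ~ A n -> word_class (Lrel A) (glue_word n) <> 1%g.
Proof.
move=> An; rewrite word_class_cat word_class_inv => /divg1_eq.
(* The unhatted lamp of index [n] changes the state of this point; the hatted one flips lamp [None]
   and fixes it. *)
move=> /word_classP/(word_act_pres_eq An)/(_ (Some n, false)).
by rewrite word_act_lamp word_act_lamphat /exchange /flip /= !eqxx.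
Qed.

Lemma glue_word_in (A : set int) n :
  A n -> word_class (Lrel A) (glue_word n) = 1%g.
Proof. by move=> An; apply/word_class_rel/Lrel_glue. Qed.

(** * From a depth bound to a computable modulus *)

Local Open Scope classical_set_scope.

Lemma depth_bound_progression (A : set int) n N k :
  ~ A n -> 4 * `|n|%N + 2 <= N -> depth_bound (L_gens A) N k ->
  progression n k`! `<=` ~` A.
Proof.
move=> An le_nN bound _ [m _ <-] Am.
have [] := bound (word_class (Lrel A) (glue_word n)).
- exact: glue_word_neq1.
- by apply: length_le_word; rewrite size_glue_word.
move=> Q [phi [_ leQk]]; apply.
have [psi <-] := multiplicative_UMagmaMorphism phi.
(* The 1 on the right becomes the image of the gluing word at the index of the progression assumed
   to lie in [A]; both sides then agree by periodicity. *)
rewrite -(gmulf1 (s := psi)) -(glue_word_in Am) !glue_word_classE.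
rewrite !(gmulfM, gmulfV, gmulf_expgz) !expgz_progression ?fact_gt0 //.
all: exact: expg_fact_card.
Qed.

Lemma leq_int_code n : `|n|%N <= int_code n.
Proof. by case: n => k /=; lia. Qed.

Theorem proposition7 (A : set int) (rhoLA : nat -> nat) :
  recursive_set A ->
  PT_closed A ->
  ~ effectively_closed A ->
  is_depth_function (L_gens A) rhoLA ->
  ~ exists f : nat -> nat, recursive_fun f /\ (forall n : nat, rhoLA n <= f n).
Proof.
move=> _ closedA not_eff depth [f [rec_f le_rho_f]].
apply: not_eff; split=> //.
(* The program reads the code [c] of [n] rather than its absolute value; as the latter is at most
   [c], [4 * c + 2] still bounds the length of the gluing word. *)
have rec_len : recursive_fun (fun c => 4 * c + 2).
  have rec2 := recursive_add recursive_id recursive_id.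
  have := recursive_add (recursive_add rec2 rec2) (recursive_const 2).
  by congr recursive_fun; apply/funext => c; lia.
have [e e_fact] := recursive_comp recursive_fact (recursive_comp rec_f rec_len).
exists e => n An; exists (f (4 * int_code n + 2))`!; split.
- exact: e_fact.
- exact: fact_gt0.
- apply: (depth_bound_progression (N := 4 * int_code n + 2) An).
    by have := leq_int_code n; lia.
  (* Depth bounds are monotone in the order allowed, so the value of [f] may replace that of
     [rhoLA]. *)
  move=> g g1 /((depth _).1 g g1)[Q [phi [surj leQ phig]]].
  by exists Q, phi; split=> //; apply: leq_trans leQ (le_rho_f _).
Qed.
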